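(* Let $R$ be a p.q.-Baer $*$-ring. If the complement $\Gamma^*_s(R)^c$ of the strong zero-divisor graph of $R$ is connected, then $\mathrm{diam}(\Gamma^*_s(R)^c)=2$ and $\mathrm{gr}(\Gamma^*_s(R)^c)=3$.
   Context: A $*$-ring is a ring $R$ with an involution $x\mapsto x^*$. A projection is an element $e$ with $e^2=e=e^*$; a central projection is a projection in the centre of $R$. For $S\subseteq R$, $r_R(S)=\{x\in R: sx=0\ \forall s\in S\}$. $R$ is a p.q.-Baer $*$-ring if for every $a\in R$, $r_R(aR)=eR$ for some projection $e\in R$. The strong zero-divisor graph $\Gamma^*_s(R)$ is the simple undirected graph with vertex set $\{0\neq a\in R: r_R(aR)\neq\{0\}\}$, in which distinct vertices $a,b$ are adjacent iff $aRb^*=0$. The complement $G^c$ of a simple graph $G$ has the same vertices, with distinct vertices adjacent iff they are not adjacent in $G$. The diameter is the supremum of distances between vertices; the girth $\mathrm{gr}$ is the length of a shortest cycle. *)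

(* Defs.v *)
From HB Require Import structures.
From mathcomp Require Import all_boot ssralg.
From mathcomp Require Import boolp classical_sets.
Set Implicit Arguments.
Unset Strict Implicit.
Unset Printing Implicit Defensive.

Import GRing.Theory.
Local Open Scope classical_set_scope.
Local Open Scope ring_scope.

HB.mixin Record PzRing_hasStar R of GRing.PzRing R := {
  star : R -> R;
  starD : {morph star : x y / x + y};
  starM : forall x y, star (x * y) = star y * star x;
  starK : involutive star
}.

#[short(type="starRingType")]
HB.structure Definition StarRing := {R of GRing.PzRing R & PzRing_hasStar R}.

Section StarRings.
Variable R : starRingType.
Implicit Types (a b e : R) (S : set R).

Definition is_projection e := e * e = e /\ star e = e.

Definition right_ideal a : set R := [set a * x | x in setT].

Definition rann S : set R := [set x | forall s, S s -> s * x = 0].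

End StarRings.

(* Taking a = 0 yields a projection e with R = eR; such an e is a two-sided
   identity, so working over unital rings loses no generality. *)
Definition pqBaer_star_ring (R : starRingType) :=
  forall a : R, exists2 e : R,
    is_projection e & rann (right_ideal a) = right_ideal e.

Record sgraph (T : eqType) := SGraph {
  vertex : set T;
  adj : rel T;
  adj_vertex : forall x y, adj x y -> vertex x;
  adj_sym : symmetric adj;
  adj_irr : irreflexive adj
}.

Section Graphs.
Variable T : eqType.
Implicit Types (G : sgraph T) (x y : T) (n d : nat).

Definition compl_adj G : rel T := fun x y =>
  `[< [/\ vertex G x, vertex G y, x <> y & ~ adj G x y] >].

Lemma compl_adj_vertex G x y : compl_adj G x y -> vertex G x.
Proof. by move=> /asboolP[]. Qed.

Lemma compl_adj_sym G : symmetric (compl_adj G).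
Proof.
by move=> x y; apply/asboolP/asboolP => -[Gx Gy xy nxy]; split=> //;
  [exact/nesym | rewrite adj_sym | exact/nesym | rewrite adj_sym].
Qed.

Lemma compl_adj_irr G : irreflexive (compl_adj G).
Proof. by move=> x; apply/asboolP => -[]. Qed.

Definition graph_compl G : sgraph T :=
  SGraph (@compl_adj_vertex G) (@compl_adj_sym G) (@compl_adj_irr G).

Definition is_walk G x y n :=
  exists p : seq T, [/\ path (adj G) x p, last x p = y & size p = n].

(* The empty graph is not connected. *)
Definition graph_connected G :=
  vertex G !=set0 /\
  forall x y, vertex G x -> vertex G y -> exists n, is_walk G x y n.

Definition is_distance G x y n :=
  is_walk G x y n /\ forall m, is_walk G x y m -> (n <= m)%N.

Definition diameter_le G d :=
  forall x y, vertex G x -> vertex G y ->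
    exists2 n, is_distance G x y n & (n <= d)%N.

(* d is the least upper bound of the distances; no natural number d qualifies
   when some pair of vertices is not joined by a walk. *)
Definition is_diameter G d :=
  diameter_le G d /\ forall d', diameter_le G d' -> (d <= d')%N.

Definition is_cycle G (c : seq T) := (3 <= size c)%N /\ ucycle (adj G) c.

Definition is_girth G n :=
  (exists2 c, is_cycle G c & size c = n) /\
  forall c, is_cycle G c -> (n <= size c)%N.

End Graphs.

Section StrongZeroDivisorGraph.
Variable R : starRingType.
Implicit Types a b : R.

Definition szd_vertex : set R :=
  [set a | a <> 0 /\ rann (right_ideal a) <> [set 0]].

Definition szd_adj : rel R := fun a b =>
  `[< [/\ szd_vertex a, szd_vertex b, a <> b
        & forall x, a * x * star b = 0] >].

Lemma szd_adj_vertex a b : szd_adj a b -> szd_vertex a.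
Proof. by move=> /asboolP[]. Qed.

Lemma star0 : star (0 : R) = 0.
Proof. by apply: (addrI (star 0)); rewrite -starD !addr0. Qed.

Lemma szd_adj_sym : symmetric szd_adj.
Proof.
have sym a b : szd_adj a b -> szd_adj b a.
  move=> /asboolP[Va Vb ab h]; apply/asboolP; split=> //; first exact/nesym.
  have h0 x : star (b * x * star a) = 0 by rewrite !starM starK mulrA h.
  by move=> x; rewrite -[LHS]starK h0 star0.
by move=> a b; apply/idP/idP; apply: sym.
Qed.

Lemma szd_adj_irr : irreflexive szd_adj.
Proof. by move=> a; apply/asboolP => -[]. Qed.

Definition strong_zero_divisor_graph : sgraph R :=
  SGraph szd_adj_vertex szd_adj_sym szd_adj_irr.

End StrongZeroDivisorGraph.

(* Main.v *)
From mathcomp Require Import all_boot ssralg.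
From mathcomp Require Import boolp classical_sets.
Require Import Defs.
Set Implicit Arguments.
Unset Strict Implicit.
Unset Printing Implicit Defensive.

Import GRing.Theory.
Local Open Scope classical_set_scope.
Local Open Scope ring_scope.

(** Every element [a] has a central cover [C a]: a central projection with
    [aRb = 0] iff [C a * b = 0]. In terms of covers, [a] is a vertex iff
    [C a] is neither 0 nor 1, and distinct vertices are adjacent in the
    complement iff [C a * C b <> 0].
    If [C a * C b = 0] and [C a + C b <> 1], then [C a + C b] is a common
    neighbour of [a] and [b]. If [C a + C b = 1], a walk from [a] to [b] must
    leave the elements whose cover lies below [C a], and the vertex where it
    does so is a common neighbour. This bounds the diameter by 2; the vertices
    [C a] and [1 - C a] are at distance at least 2, and a common neighbour
    [z] of them splits 1 into three nonzero orthogonal central projections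
    [C a * C z], [(1 - C a) * C z] and [1 - C z], whose complements form a
    triangle. *)

Section Star.
Variable R : starRingType.
Implicit Types a b e f : R.

Lemma star1 : star (1 : R) = 1.
Proof. by rewrite -[LHS]mul1r -[X in X * _]starK -starM mul1r starK. Qed.

Lemma starB a b : star (a - b) = star a - star b.
Proof. by apply: (addIr (star b)); rewrite -starD !subrK. Qed.

Definition central_projection e := is_projection e /\ forall x, e * x = x * e.

Lemma central_projection_compl e :
  central_projection e -> central_projection (1 - e).
Proof.
move=> [[ee se] ce]; split; first split.
- by rewrite mulrBr mulr1 mulrBl mul1r ee subrr subr0.
- by rewrite starB star1 se.
- by move=> x; rewrite mulrBr mulrBl mul1r mulr1 ce.
Qed.

Lemma central_projectionM e f :
  central_projection e -> central_projection f -> central_projection (e * f).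
Proof.
move=> [[ee se] ce] [[ff sf] cf]; split; first split.
- by rewrite mulrA -(mulrA e f e) -ce mulrA ee -mulrA ff.
- by rewrite starM se sf ce.
- by move=> x; rewrite -mulrA cf mulrA ce mulrA.
Qed.

Lemma mulr_compl e : is_projection e -> e * (1 - e) = 0.
Proof. by case=> ee _; rewrite mulrBr mulr1 ee subrr. Qed.

Lemma mulr_subl_eq0 a e : a * (1 - e) = 0 -> a = a * e.
Proof. by rewrite mulrBr mulr1 => /subr0_eq. Qed.

(** If the right annihilator of [aR] is [eR], it consists of the [b] with [e * b = b], that is
    [(1 - e) * b = 0]. So [1 - e] serves as the cover once [e] is shown to be central. *)
Lemma pqBaer_central_cover : pqBaer_star_ring R ->
  exists C : R -> R, (forall a, central_projection (C a)) /\
    forall a b, (forall x, a * x * b = 0) <-> C a * b = 0.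
Proof.
move=> hR.
suff /choice[C hC] : forall a, exists c, central_projection c /\
    forall b, (forall x, a * x * b = 0) <-> c * b = 0.
  by exists C; split=> a; case: (hC a).
move=> a; have [e [ee se] rE] := hR a.
have rannP b : (forall x, a * x * b = 0) <-> e * b = b.
  split=> [h | eb x].
    have : rann (right_ideal a) b by move=> _ [x _ <-]; exact: h.
    by rewrite rE => -[y _ <-]; rewrite mulrA ee.
  have : rann (right_ideal a) b by rewrite rE; exists b.
  by apply; exists x.
(* [rann (right_ideal a)] is an ideal, so [Re] lies in [eR]; apply [star]. *)
have eRe x : e * (x * e) = x * e.
  by apply/rannP => y; rewrite mulrA -(mulrA a); move: (y * x); apply/rannP.
have ce x : e * x = x * e.
  rewrite -(eRe x) -[LHS]starK starM se -(eRe (star x)).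
  by rewrite !starM starK se mulrA.
exists (1 - e); split; first by apply: central_projection_compl.
move=> b; rewrite rannP mulrBl mul1r; split=> [-> | /subr0_eq //].
by rewrite subrr.
Qed.

End Star.

Section CentralCover.
Variables (R : starRingType) (C : R -> R).
Hypothesis C_central : forall a, central_projection (C a).
Hypothesis CP : forall a b, (forall x, a * x * b = 0) <-> C a * b = 0.
Implicit Types a b e f z : R.

Let G := graph_compl (strong_zero_divisor_graph R).

Let CC a : C a * C a = C a. Proof. by case: (C_central a) => -[]. Qed.
Let CK a x : C a * x = x * C a. Proof. by case: (C_central a) => _; apply. Qed.

(** Each of the two central projections lies below the other: [CP] turns [e * (1 - e) = 0] into
    [C e * (1 - e) = 0], and [C e * (1 - C e) = 0] into [e * (1 - C e) = 0]. *)
Lemma cover_proj e : central_projection e -> C e = e.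
Proof.
move=> pe; have [ie ce] := pe.
have /mulr_subl_eq0 -> : C e * (1 - e) = 0.
  by apply/CP => x; rewrite ce -mulrA mulr_compl // mulr0.
rewrite CK; apply/esym/mulr_subl_eq0.
have /CP/(_ 1) : C e * (1 - C e) = 0 by apply: mulr_compl; case: (C_central e).
by rewrite mulr1.
Qed.

Lemma cover_eq0 a : C a = 0 <-> a = 0.
Proof.
split=> [Ca | ->]; last first.
  by rewrite -[LHS]mulr1; apply/CP => x; rewrite !mul0r.
have /CP/(_ 1) : C a * 1 = 0 by rewrite Ca mul0r.
by rewrite !mulr1.
Qed.

(** By [CP] the right annihilator of [aR] is that of [C a], and it contains [1 - C a]. *)
Lemma szd_vertexP a : szd_vertex a <-> C a <> 0 /\ C a <> 1.
Proof.
rewrite cover_eq0; split=> -[a0 h]; split=> // Ca; apply: h.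
  apply/seteqP; split=> [b hb | b -> s _]; last by rewrite mulr0.
  by rewrite /= -[b]mul1r -Ca; apply/CP => x; apply: hb; exists x.
have : rann (right_ideal a) (1 - C a).
  move=> _ [x _ <-]; move: x; apply/CP.
  by apply: mulr_compl; case: (C_central a).
by rewrite Ca => /= /subr0_eq.
Qed.

(** The involution disappears because [C a] is self-adjoint: applying [star] to [C a * star b = 0]
    gives [b * C a = 0]. Centrality of [C a] then allows a second use of [CP], now for [b]. *)
Lemma cover_orthogonal a b :
  (forall x, a * x * star b = 0) <-> C a * C b = 0.
Proof.
rewrite CP; have [[_ sa] _] := C_central a.
have -> : C a * star b = 0 <-> b * C a = 0.
  split=> h; first by rewrite -[LHS]starK starM sa h star0.
  by rewrite -[LHS]starK starM sa starK h star0.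
rewrite [C a * C b]CK -CP; split=> [h x | /(_ 1)]; last by rewrite mulr1.
by rewrite -mulrA -CK mulrA h mul0r.
Qed.

Lemma compl_adjP a b :
  adj G a b <-> [/\ szd_vertex a, szd_vertex b, a <> b & C a * C b <> 0].
Proof.
split=> [/asboolP[Va Vb ab nab] | [Va Vb ab nab]]; last apply/asboolP.
  split=> // /cover_orthogonal h; apply: nab; apply/asboolP; by split.
by split=> // /asboolP[_ _ _ /cover_orthogonal].
Qed.

(** Since [C a + C b = 1], the second hypothesis puts every vertex cover below [C b] or below [C a].
    No edge joins the two classes, because covers taken from different classes are orthogonal. *)
Lemma walk_below_cover a b w p :
  C a + C b = 1 ->
  (forall z, szd_vertex z -> C a * C z = 0 \/ C z * C b = 0) ->
  path (adj G) w p -> C w * C b = 0 -> C (last w p) * C b = 0.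
Proof.
move=> ab1 hz; elim: p w => //= w' p IH w /andP[/compl_adjP[_ Vw' _ ww'] pp] wb.
apply: IH => //; case: (hz _ Vw') => // aw'; case: ww'.
have -> : C w' = C w' * C b by rewrite -[LHS]mulr1 -ab1 mulrDr -CK aw' add0r.
by rewrite [C w' * _]CK mulrA wb mul0r.
Qed.

Lemma common_neighbour a b : graph_connected G ->
  szd_vertex a -> szd_vertex b -> C a * C b = 0 ->
  exists z, [/\ szd_vertex z, C a * C z <> 0 & C z * C b <> 0].
Proof.
move=> [_ hc] Va Vb ab.
have [a0 a1] := (szd_vertexP a).1 Va; have [b0 b1] := (szd_vertexP b).1 Vb.
have [ab1 | ab1] := pselect (C a + C b = 1).
  have [_ [p [pp pb _]]] := hc a b Va Vb.
  (* Without a common neighbour the walk from [a] stays below [C a] up to its end [b], so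
     [C b = C b * C b = 0]. *)
  apply: contrapT => nz; apply: b0.
  rewrite -CC -{1}pb; apply: (walk_below_cover ab1) => // z Vz.
  have [az | az] := pselect (C a * C z = 0); first by left.
  have [zb | zb] := pselect (C z * C b = 0); first by right.
  by case: nz; exists z.
have ba : C b * C a = 0 by rewrite CK.
have Cz : C (C a + C b) = C a + C b.
  apply: cover_proj; split; first split.
  - by rewrite mulrDl !mulrDr !CC ab ba addr0 add0r.
  - have [[_ sa] _] := C_central a; have [[_ sb] _] := C_central b.
    by rewrite starD sa sb.
  - by move=> x; rewrite mulrDl mulrDr !CK.
have az : C a * (C a + C b) = C a by rewrite mulrDr CC ab addr0.
exists (C a + C b); rewrite Cz az mulrDl ab CC add0r; split=> //.
apply/szd_vertexP; rewrite Cz; split=> // z0.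
by apply: a0; rewrite -az z0 mulr0.
Qed.

Lemma compl_vertex e : central_projection e -> e <> 0 -> e <> 1 ->
  szd_vertex (1 - e) /\ C (1 - e) = 1 - e.
Proof.
move=> pe e0 e1; have Ce := cover_proj (central_projection_compl pe).
split=> //; apply/szd_vertexP; rewrite Ce; split=> [/subr0_eq/esym // | h].
by apply: e0; apply: oppr_inj; apply: (addrI 1); rewrite h oppr0 addr0.
Qed.

(** The covers of the two vertices are [1 - p] and [1 - q], whose product is [1 - p - q = r]. *)
Lemma compl_triangle_adj p q r :
  central_projection p -> central_projection q ->
  p + q + r = 1 -> p * q = 0 -> p <> 0 -> q <> 0 -> r <> 0 ->
  adj G (1 - p) (1 - q).
Proof.
move=> pp pq pqr pq0 p0 q0 r0.
have [[p_id _] _] := pp.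
have p1 : p <> 1 by move=> p1; apply: q0; rewrite -[q]mul1r -p1.
have q1 : q <> 1 by move=> q1; apply: p0; rewrite -[p]mulr1 -q1.
have [Vp Cp] := compl_vertex pp p0 p1; have [Vq Cq] := compl_vertex pq q0 q1.
apply/compl_adjP; split=> //; last rewrite Cp Cq.
  by move=> /addrI/oppr_inj pEq; apply: p0; rewrite -p_id {2}pEq.
move=> h; apply: r0; move: h.
rewrite mulrBl mul1r mulrBr mulr1 pq0 subr0 -pqr.
by rewrite [p + q + r - q]addrAC addrK [p + r]addrC addrK.
Qed.

Lemma compl_is_distance_le2 a b : graph_connected G ->
  szd_vertex a -> szd_vertex b -> exists2 n, is_distance G a b n & (n <= 2)%N.
Proof.
move=> hc Va Vb; have [<- | ab] := pselect (a = b).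
  by exists 0%N => //; split=> //; exists [::].
have walk0 : ~ is_walk G a b 0 by move=> [[|x p] [_ //= /ab]].
have [gab | gab] := boolP (adj G a b).
  exists 1%N => //; split; first by exists [:: b]; rewrite /= andbT.
  by case=> // /walk0.
have Cab : C a * C b = 0.
  by apply: contrapT => nab; case/negP: gab; apply/compl_adjP.
have [z [Vz az zb]] := common_neighbour hc Va Vb Cab.
exists 2%N => //; split.
  exists [:: z; b]; split=> //=; rewrite andbT; apply/andP; split.
    apply/compl_adjP; split=> // azE; apply: zb; by rewrite -azE.
  apply/compl_adjP; split=> // zbE; apply: az; by rewrite zbE.
case=> [/walk0 // | [|//] [[|c [|c' p]] [//= + cb _]]].
by rewrite andbT cb => ?; case/negP: gab.
Qed.

Lemma compl_is_diameter2 : graph_connected G -> is_diameter G 2.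
Proof.
move=> hc; split=> [a b Va Vb|d hd]; first exact: compl_is_distance_le2.
have [[a Va] _] := hc; have [a0 a1] := (szd_vertexP a).1 Va.
have Cf := cover_proj (C_central a).
have [Vf' Cf'] := compl_vertex (C_central a) a0 a1.
have Vf : szd_vertex (C a) by apply/szd_vertexP; rewrite Cf.
have ff' : C a * (1 - C a) = 0 by apply: mulr_compl; case: (C_central a).
have [n [[p [pp pl <-]] _]] := hd _ _ Vf Vf'.
(* Length 0 would give [C a = 1 - C a], hence [C a = C a * C a = 0]; length 1 would contradict
   [ff']. *)
apply: leq_trans; case: p pp pl => [_ /= fE | x [|y p] //=].
  by case: a0; rewrite -CC {2}fE.
by rewrite andbT => + xE; rewrite xE => /compl_adjP[_ _ _]; rewrite Cf Cf'.
Qed.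

Lemma compl_is_girth3 : graph_connected G -> is_girth G 3.
Proof.
move=> hc; split; last by move=> c [].
have [[a Va] _] := hc; have [a0 a1] := (szd_vertexP a).1 Va.
have [Va' Ca'] := compl_vertex (C_central a) a0 a1.
have aa' : C a * (1 - C a) = 0 by apply: mulr_compl; case: (C_central a).
have := common_neighbour hc Va Va'; rewrite Ca' => /(_ aa')[z [Vz]].
have [_ z1] := (szd_vertexP z).1 Vz.
have zz' : C z * (1 - C z) = 0 by apply: mulr_compl; case: (C_central z).
rewrite [C z * _]CK; have pa' := central_projection_compl (C_central a).
have pp := central_projectionM (C_central a) (C_central z).
have pq := central_projectionM pa' (C_central z).
have pr := central_projection_compl (C_central z).
have pq0 : C a * C z * ((1 - C a) * C z) = 0.
  by rewrite -mulrA [C z * _]CK !mulrA aa' !mul0r.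
have pr0 : C a * C z * (1 - C z) = 0 by rewrite -mulrA zz' mulr0.
have qr0 : (1 - C a) * C z * (1 - C z) = 0 by rewrite -mulrA zz' mulr0.
have pqr : C a * C z + (1 - C a) * C z + (1 - C z) = 1.
  by rewrite -mulrDl [C a + _]addrC subrK mul1r addrC subrK.
have r0 : 1 - C z <> 0 by move/subr0_eq/esym.
(* [p] and [q] are nonzero because [z] is a common neighbour of [a] and [1 - C a]; [r] is nonzero
   because [C z <> 1] for a vertex. *)
move: pp pq pr pq0 pr0 qr0 pqr r0.
set p := C a * C z; set q := _ * C z; set r := 1 - C z.
move=> pp pq pr pq0 pr0 qr0 pqr r0 p0 q0.
have g1 : adj G (1 - p) (1 - q) by apply: (compl_triangle_adj (r := r)).
have g2 : adj G (1 - q) (1 - r).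
  by apply: (compl_triangle_adj (r := p)) => //; rewrite addrC addrA.
have g3 : adj G (1 - p) (1 - r).
  by apply: (compl_triangle_adj (r := q)) => //; rewrite addrAC.
have neq x y : adj G x y -> x != y.
  by apply: contraTneq => ->; rewrite adj_irr.
exists [:: 1 - p; 1 - q; 1 - r] => //; split=> //; apply/andP; split.
  by apply/and4P; split=> //; rewrite adj_sym.
by rewrite /= !inE !negb_or !neq.
Qed.

End CentralCover.

Theorem theorem4p12 (R : starRingType) (hR : pqBaer_star_ring R)
    (hconn : graph_connected (graph_compl (strong_zero_divisor_graph R))) :
  is_diameter (graph_compl (strong_zero_divisor_graph R)) 2 /\
  is_girth (graph_compl (strong_zero_divisor_graph R)) 3.
Proof.
have [C [C_central CP]] := pqBaer_central_cover hR.
split; first exact: (compl_is_diameter2 C_central CP).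
exact: (compl_is_girth3 C_central CP).
Qed.
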